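(* Let $M=[m_{ij}]\in\mathbb{R}^{n\times n}$ be a $B$-matrix, and write $M=B^++C$, where $B^+=[b_{ij}]\in\mathbb{R}^{n\times n}$ has entries $b_{ij}=m_{ij}-r_i^+$ with $r_i^+=\max\{0,\ m_{ij}\mid j\neq i\}$. For $k=1,\dots,n$ let $$l_k(B^+)=\max_{k\le i\le n}\left\{\frac{1}{|b_{ii}|}\sum_{j=k,\ j\neq i}^{n}|b_{ij}|\right\},$$ and for $i=1,\dots,n$ let $$\bar\beta_i=b_{ii}-\sum_{j=i+1}^{n}|b_{ij}|\,l_i(B^+).$$ Then $$\max_{d\in[0,1]^n}\left\|(I-D+DM)^{-1}\right\|_\infty\ \le\ \sum_{i=1}^{n}\frac{n-1}{\min\{\bar\beta_i,1\}}\prod_{j=1}^{i-1}\frac{b_{jj}}{\bar\beta_j},$$ where $D=\mathrm{diag}(d_1,\dots,d_n)$ for $d=(d_1,\dots,d_n)\in[0,1]^n$, and the product $\prod_{j=1}^{i-1}\frac{b_{jj}}{\bar\beta_j}$ is $1$ if $i=1$.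
   Context: A real matrix $M=[m_{ij}]\in\mathbb{R}^{n\times n}$ is called a $B$-matrix if for each $i\in\{1,\dots,n\}$, $$\sum_{k=1}^n m_{ik}>0\quad\text{and}\quad \frac1n\left(\sum_{k=1}^n m_{ik}\right)>m_{ij}\ \text{ for every } j\in\{1,\dots,n\},\ j\neq i.$$ $I$ is the $n\times n$ identity matrix and $\|\cdot\|_\infty$ is the matrix norm induced by the vector $\infty$-norm (maximum absolute row sum). Empty sums are $0$. Every $B$-matrix is a $P$-matrix (all principal minors are positive).
   Formalization: The formal theorem assumes n ≥ 2; for n = 1 the stated inequality is false, since its right-hand side is 0 (factor n−1) while d = 0 gives norm 1 on the left. *)

(* Defs.v *)
From HB Require Import structures.
From mathcomp Require Import all_boot all_order all_algebra.
From mathcomp Require Import all_classical all_reals.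

Set Implicit Arguments.
Unset Strict Implicit.
Unset Printing Implicit Defensive.

Import Order.TTheory GRing.Theory Num.Theory.
Local Open Scope classical_set_scope.
Local Open Scope ring_scope.

Definition B_matrix (R : realType) (n : nat) (M : 'M[R]_n) : Prop :=
  forall i : 'I_n,
    0 < \sum_(k < n) M i k /\
    (forall j : 'I_n, j != i -> M i j < n%:R^-1 * \sum_(k < n) M i k).

Definition rplus (R : realType) (n : nat) (M : 'M[R]_n) (i : 'I_n) : R :=
  \big[Num.max/0]_(j < n | j != i) M i j.

Definition Bplus (R : realType) (n : nat) (M : 'M[R]_n) : 'M[R]_n :=
  \matrix_(i, j) (M i j - rplus M i).

(* Indices are 0-based: k : 'I_n stands for the 1-based index k + 1. The
   maximum is over a nonempty family (i = k is allowed) of nonnegative reals,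
   so the seed 0 of the iterated maximum does not affect its value. *)
Definition lcoef (R : realType) (n : nat) (B : 'M[R]_n) (k : 'I_n) : R :=
  \big[Num.max/0]_(i < n | (k <= i)%N)
    (1 / `|B i i| * \sum_(j < n | (k <= j)%N && (j != i)) `|B i j|).

(* For B = Bplus M with M a B-matrix, B i i and beta_bar B i are positive. *)
Definition beta_bar (R : realType) (n : nat) (B : 'M[R]_n) (i : 'I_n) : R :=
  B i i - \sum_(j < n | (i < j)%N) `|B i j| * lcoef B i.

(* Maximum absolute row sum, i.e. the norm induced by the vector oo-norm
   (see mxnorm_oo_ge and mxnorm_oo_attained); the library norm `|A| on
   matrices is the largest absolute value of an entry instead. *)
Definition mxnorm_oo (R : realType) (m n : nat) (A : 'M[R]_(m, n)) : R :=
  \big[Num.max/0]_(i < m) \sum_(j < n) `|A i j|.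

Lemma mxnorm_oo_ge (R : realType) (m n : nat) (A : 'M[R]_(m, n))
    (x : 'cV[R]_n) :
  mxnorm_oo (A *m x) <= mxnorm_oo A * mxnorm_oo x.
Proof.
have nrm_ge0 p q (X : 'M[R]_(p, q)) : 0 <= mxnorm_oo X.
  exact: bigmax_ge_id.
apply/bigmax_leP; split=> [|i _]; first exact: mulr_ge0.
rewrite big_ord1 mxE; apply: le_trans (ler_norm_sum _ _ _) _.
apply: (@le_trans _ _ ((\sum_(j < n) `|A i j|) * mxnorm_oo x)).
  rewrite mulr_suml; apply: ler_sum => j _; rewrite normrM ler_wpM2l //.
  have /= := le_bigmax 0 (fun j : 'I_n => \sum_(k < 1) `|x j k|) j.
  by rewrite big_ord1.
apply: ler_wpM2r => //.
exact: (le_bigmax 0 (fun i : 'I_m => \sum_(j < n) `|A i j|)).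
Qed.

Lemma mxnorm_oo_attained (R : realType) (m n : nat) (A : 'M[R]_(m, n)) :
  exists2 x : 'cV[R]_n, mxnorm_oo x <= 1 & mxnorm_oo (A *m x) = mxnorm_oo A.
Proof.
case: m A => [|m] A.
  by exists 0; rewrite /mxnorm_oo ?big_ord0 //; apply/bigmax_leP; split=> // i _;
     rewrite big_ord1 mxE normr0.
pose f (i : 'I_m.+1) : R := \sum_(j < n) `|A i j|.
have f_ge0 i : xpredT i -> 0 <= f i by move=> _; apply: sumr_ge0.
have := @bigmax_eq_arg _ _ _ 0 ord0 xpredT f isT f_ge0.
set i := [arg max_(i > ord0) f i]%O => Ei.
pose x : 'cV[R]_n := \col_j Num.sg (A i j).
have x_le1 : mxnorm_oo x <= 1.
  apply/bigmax_leP; split=> // j _.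
  by rewrite big_ord1 mxE normr_sg; case: (_ != _).
exists x => //; apply/eqP; rewrite eq_le; apply/andP; split.
  apply: le_trans (mxnorm_oo_ge _ _) _.
  by apply: ler_piMr => //; apply: bigmax_ge_id.
rewrite {1}/mxnorm_oo Ei /f.
have /= := le_bigmax 0 (fun k : 'I_m.+1 => \sum_(l < 1) `|(A *m x) k l|) i.
apply: le_trans; rewrite big_ord1 mxE; apply: le_trans (ler_norm _).
by apply: ler_sum => j _; rewrite mxE mulrC -normrEsg.
Qed.

Definition is_maximum (R : realType) (A : set R) (x : R) : Prop :=
  A x /\ ubound A x.

Definition unit_cube (R : realType) (n : nat) : set 'rV[R]_n :=
  [set d | forall i : 'I_n, 0 <= d 0 i <= 1].
Arguments unit_cube : clear implicits.

Definition lcp_mx (R : realType) (n : nat) (M : 'M[R]_n) (d : 'rV[R]_n)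
    : 'M[R]_n :=
  1%:M - diag_mx d + diag_mx d *m M.

(* Main.v *)
(* Write M_D = I - D + D M = B_D + c e^T with B_D = I - D + D B^+, c >= 0 and
   e the all-ones vector. B_D is a strictly diagonally dominant Z-matrix with
   positive diagonal, so x = B_D^-1 c >= 0, and M_D^-1 is
   (I - x e^T / (1 + e^T x)) B_D^-1, whose first factor has norm at most n - 1.
   The norm of B_D^-1 is bounded by induction on trailing blocks: eliminating
   the column of the first index k of a block uses the solution z of the smaller
   block with that column as right-hand side, and diagonal dominance gives
   |z_j| <= l_k, which turns the pivot into b_kk - sum_(j > k) |b_kj| l_k.
   The maximum over d exists by compactness of the cube and Cramer's rule. *)
Require Import Defs.
From mathcomp Require Import all_boot all_order all_algebra.
From mathcomp Require Import all_classical all_reals.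
From mathcomp Require Import topology normedtype derive.
From mathcomp Require Import ring lra zify.

Set Implicit Arguments.
Unset Strict Implicit.
Unset Printing Implicit Defensive.

Import Order.TTheory GRing.Theory Num.Theory.
Import numFieldNormedType.Exports.
Local Open Scope classical_set_scope.
Local Open Scope ring_scope.

(** * Linear systems with a strictly diagonally dominant block *)

Definition sdd (R : numDomainType) (n : nat) (A : 'M[R]_n) : Prop :=
  forall i : 'I_n, \sum_(j < n | j != i) `|A i j| < A i i.

Lemma unitmx_ker0 (F : fieldType) (n : nat) (A : 'M[F]_n) :
  (forall x : 'cV[F]_n, A *m x = 0 -> x = 0) -> A \in unitmx.
Proof.
move=> A_inj; rewrite -unitmx_tr -row_free_unit -kermx_eq0; apply/eqP.
apply: trmx_inj; rewrite trmx0; apply/matrixP => i j.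
have /A_inj : A *m col j (kermx A^T)^T = 0.
  by rewrite colE mulmxA -{1}[A]trmxK -trmx_mul mulmx_ker trmx0 mul0mx.
by move/matrixP/(_ i 0); rewrite !mxE.
Qed.

Lemma sdd_diag_gt0 (R : realFieldType) (n : nat) (A : 'M[R]_n) (i : 'I_n) :
  sdd A -> 0 < A i i.
Proof. by move=> Asdd; apply: le_lt_trans (Asdd i); apply: sumr_ge0. Qed.

Lemma sdd_sub (R : realFieldType) (n : nat) (A : 'M[R]_n) (P : pred 'I_n)
    (i : 'I_n) :
  sdd A -> \sum_(j < n | P j && (j != i)) `|A i j| < A i i.
Proof.
move=> Asdd; apply: le_lt_trans (Asdd i).
rewrite [leRHS](bigID P) /=.
under [X in X + _]eq_bigl do rewrite andbC.
by rewrite lerDl sumr_ge0.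
Qed.

Lemma sdd_tail (R : realFieldType) (n : nat) (A : 'M[R]_n) (i : 'I_n) :
  sdd A -> \sum_(j < n | (i < j)%N) `|A i j| < A i i.
Proof.
move=> /(sdd_sub (fun j : 'I_n => (i < j)%N) i); congr (_ < _).
apply: eq_bigl => j; case: ltnP => ij; rewrite ?andbT //.
by rewrite -val_eqE /= gtn_eqF.
Qed.

(** At an index [m] of [P] where [|x m|] is largest, the off-diagonal terms cost at most
    [S * |x m|], so row [m] leaves [gap * |x m| <= s * gap]. Scaling the row bounds by the dominance
    gap serves two uses: [s = 0] gives uniqueness, [s = 1] bounds the eliminated column. *)
Lemma sdd_bound (R : realFieldType) (n : nat) (A : 'M[R]_n) (P : pred 'I_n)
    (x : 'I_n -> R) (s : R) :
  sdd A ->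
  (forall i, P i -> `|\sum_(j < n | P j) A i j * x j| <=
     s * (A i i - \sum_(j < n | P j && (j != i)) `|A i j|)) ->
  forall i, P i -> `|x i| <= s.
Proof.
move=> Asdd Ax i Pi.
case: (arg_maxP (fun j => `|x j|) Pi) => m Pm xmax.
apply: le_trans (xmax i Pi) _.
have := Ax m Pm; rewrite (bigD1 m) //=.
set S := \sum_(j < n | _) `|_|; set T := \sum_(j < n | _) _ => AxT.
have gap : 0 < A m m - S.
  by rewrite subr_gt0 sdd_sub.
have leT : `|T| <= S * `|x m|.
  apply: le_trans (ler_norm_sum _ _ _) _; rewrite mulr_suml.
  apply: ler_sum => j /andP[Pj _]; rewrite normrM ler_wpM2l //.
  exact: xmax.
have S0 : 0 <= S by apply: sumr_ge0.
have A0 : `|A m m| = A m m by apply: ger0_norm; lra.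
rewrite -(ler_pM2r gap).
have : `|A m m * x m| <= `|A m m * x m + T| + `|T|.
  by rewrite -{1}(addrK T (A m m * x m)) ler_normB.
rewrite normrM A0; nra.
Qed.

Lemma sdd_solve (R : realFieldType) (n : nat) (A : 'M[R]_n) (P : pred 'I_n)
    (y : 'I_n -> R) :
  sdd A ->
  exists x : 'I_n -> R, forall i, P i -> \sum_(j < n | P j) A i j * x j = y i.
Proof.
move=> Asdd.
(* The block on [P] is completed by the identity outside [P], so that a full-size invertible matrix
   replaces a reindexed submatrix. *)
pose T := \matrix_(i, j) (if P i then (if P j then A i j else 0)
                          else (i == j)%:R) : 'M[R]_n.
have TP (x : 'cV[R]_n) i :
    P i -> (T *m x) i 0 = \sum_(j < n | P j) A i j * x j 0.
  move=> Pi; rewrite mxE big_mkcond [RHS]big_mkcond; apply: eq_bigr => j _.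
  by rewrite mxE Pi; case: (P j); rewrite ?mul0r.
have Tu : T \in unitmx.
  apply: unitmx_ker0 => x Tx0; apply/matrixP => i j; rewrite ord1 [RHS]mxE.
  have [Pi|nPi] := boolP (P i).
    apply/eqP; rewrite -normr_le0.
    apply: (@sdd_bound _ _ A P (fun j => x j 0)) => // k Pk.
    by rewrite -TP // Tx0 mxE normr0 mul0r.
  have : (T *m x) i 0 = 0 by rewrite Tx0 mxE.
  rewrite mxE (bigD1 i) //= big1 ?addr0 => [|k ki].
    by rewrite mxE (negPf nPi) eqxx mul1r.
  by rewrite mxE (negPf nPi) eq_sym (negPf ki) mul0r.
exists (fun j => (invmx T *m (\col_i y i)) j 0) => i Pi.
by rewrite -TP // mulKVmx // mxE.
Qed.

(** At an index [m] minimizing [x], the signs of the off-diagonal entries bound row [m] by the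
    dominance gap times [x m], which would be negative if [x m] were. *)
Lemma sdd_monotone (R : realFieldType) (n : nat) (A : 'M[R]_n)
    (x : 'I_n -> R) :
  sdd A -> (forall i j, j != i -> A i j <= 0) ->
  (forall i, 0 <= \sum_j A i j * x j) -> forall i, 0 <= x i.
Proof.
move=> Asdd Aoff Ax i.
case: (@arg_minP _ _ _ i xpredT x isT) => m _ xmin.
apply: le_trans (xmin i isT); rewrite leNgt; apply/negP => xm0.
have := Ax m; rewrite (bigD1 m) //= leNgt => /negP; apply.
have : \sum_(j < n | j != m) A m j * x j <=
    \sum_(j < n | j != m) - `|A m j| * x m.
  apply: ler_sum => j jm.
  by rewrite ler0_norm ?Aoff // opprK ler_wnM2l ?Aoff ?xmin.
rewrite -mulr_suml sumrN => le1; have := Asdd m; nra.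
Qed.

(** * Elimination along trailing blocks *)

(** Unrolled form of the recursion [T k = p k + q k * T k.+1] produced by one elimination step. The
    index [k] is a natural number so that the empty block [k = n], with value 0, is included. *)
Definition tail_bound (R : realFieldType) (n : nat) (p q : 'I_n -> R)
    (k : nat) : R :=
  \sum_(i < n | (k <= i)%N) p i * \prod_(j < n | (k <= j < i)%N) q j.

Lemma tail_bound_rec (R : realFieldType) (n : nat) (p q : 'I_n -> R)
    (k : 'I_n) :
  tail_bound p q k = p k + q k * tail_bound p q k.+1.
Proof.
rewrite /tail_bound (bigD1 k) //= big_pred0 ?mulr1; last first.
  by move=> j; rewrite [RHS]/=; case: ltngtP.
congr (_ + _); rewrite mulr_sumr; apply: eq_big => [i|i /andP[ki ik]].
  by rewrite [RHS]ltn_neqAle andbC eq_sym.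
have lt_ki : (k < i)%N by rewrite ltn_neqAle eq_sym ki andbT.
rewrite mulrCA (bigD1 k) /= ?leqnn ?lt_ki //; congr (_ * (_ * _)).
apply: eq_bigl => j; rewrite [in RHS]ltn_neqAle [k == j :> nat]eq_sym.
by rewrite andbC andbA.
Qed.

Lemma tail_bound_ge0 (R : realFieldType) (n : nat) (p q : 'I_n -> R)
    (k : nat) :
  (forall i, 0 <= p i) -> (forall i, 0 <= q i) -> 0 <= tail_bound p q k.
Proof.
by move=> p0 q0; apply: sumr_ge0 => i _; rewrite mulr_ge0 ?prodr_ge0.
Qed.

(* [l], [p], [q] stand for [lcoef], [1 / min(beta_bar, 1)] and [b_kk / beta_bar];
   leaving them abstract lets [A = I - D + D B^+] be estimated directly with the
   coefficients of [B^+]. *)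
Lemma trailing_bound (R : realFieldType) (n : nat) (A : 'M[R]_n)
    (l p q : 'I_n -> R) :
  sdd A ->
  (forall k, 0 <= l k <= 1) ->
  (forall k i : 'I_n, (k < i)%N ->
     \sum_(j < n | (k <= j)%N && (j != i)) `|A i j| <= l k * A i i) ->
  (forall k, 1 <= p k * (A k k - \sum_(j < n | (k < j)%N) `|A k j| * l k)) ->
  (forall k,
     A k k <= q k * (A k k - \sum_(j < n | (k < j)%N) `|A k j| * l k)) ->
  forall (x : 'I_n -> R) (Y : R) (k : nat), 0 <= Y ->
  (forall i : 'I_n, (k <= i)%N ->
     `|\sum_(j < n | (k <= j)%N) A i j * x j| <= Y) ->
  forall i : 'I_n, (k <= i)%N -> `|x i| <= Y * tail_bound p q k.
Proof.
move=> Asdd l01 lA pA qA x Y k Y0.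
have b0 i : 0 < A i i - \sum_(j < n | (i < j)%N) `|A i j| * l i.
  rewrite subr_gt0; apply: le_lt_trans (sdd_tail i Asdd).
  rewrite -mulr_suml; apply: ler_piMr; first exact: sumr_ge0.
  by case/andP: (l01 i).
have p0 i : 0 <= p i.
  by rewrite -(pmulr_lge0 _ (b0 i)); apply: le_trans (pA i).
have q0 i : 0 <= q i.
  rewrite -(pmulr_lge0 _ (b0 i)); apply: le_trans (qA i).
  exact/ltW/sdd_diag_gt0.
have [m] := ubnP (n - k); elim: m k x => // m IHm k x nkm Ax i ki.
have kn : (k < n)%N by apply: leq_ltn_trans ki (ltn_ord i).
pose K := Ordinal kn.
have -> : tail_bound p q k = p K + q K * tail_bound p q k.+1.
  exact: tail_bound_rec p q K.
set T := tail_bound p q k.+1.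
have T0 : 0 <= T by apply: tail_bound_ge0.
have splitK (f : 'I_n -> R) : \sum_(j < n | (k <= j)%N) f j =
    f K + \sum_(j < n | (k < j)%N) f j.
  rewrite (bigD1 K) //=; congr (_ + _); apply: eq_bigl => j.
  by rewrite ltn_neqAle andbC eq_sym.
have [z zE] := @sdd_solve _ _ A (fun j : 'I_n => (k < j)%N)
  (fun j => A j K) Asdd.
have splitKi (f : 'I_n -> R) (j : 'I_n) : (k < j)%N ->
    \sum_(h < n | (k <= h)%N && (h != j)) f h =
    f K + \sum_(h < n | (k < h)%N && (h != j)) f h.
  move=> kj; have Kj : K != j by rewrite -val_eqE /= neq_ltn kj.
  rewrite (bigD1 K) /= ?leqnn //; congr (_ + _); apply: eq_bigl => h.
  rewrite andbAC [(k < h)%N]ltn_neqAle [k == _]eq_sym.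
  by rewrite [(_ != _) && (k <= h)%N]andbC.
(* Dominance in the larger block puts [|A h K|] below the gap of row [h] in the smaller block,
   whence the crude bound 1. Feeding it back into row [j] then improves it to [l K]. *)
have z1 (j : 'I_n) : (k < j)%N -> `|z j| <= 1.
  move=> kj; apply: (@sdd_bound _ _ A (fun j : 'I_n => (k < j)%N)) => // h kh.
  rewrite zE // mul1r.
  by have := @sdd_sub _ _ A (fun j : 'I_n => (k <= j)%N) h Asdd;
    rewrite splitKi //; lra.
have zl (j : 'I_n) : (k < j)%N -> `|z j| <= l K.
  move=> kj; rewrite -(ler_pM2r (@sdd_diag_gt0 _ _ _ j Asdd)).
  apply: le_trans (lA K j kj); rewrite splitKi //.
  have := zE j kj; rewrite (bigD1 j) //= => /(canRL (addrK _)) AzE.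
  rewrite -[A j j]gtr0_norm ?sdd_diag_gt0 // -normrM mulrC AzE.
  apply: le_trans (ler_normB _ _) _; rewrite lerD2l.
  apply: le_trans (ler_norm_sum _ _ _) _; apply: ler_sum => h /andP[kh _].
  by rewrite normrM ler_piMr // z1.
have xT (j : 'I_n) : (k < j)%N -> `|x j| <= Y * T + l K * `|x K|.
  move=> kj.
  (* On the rows below [K], the smaller block applied to [x + x K * z] gives the rows of the larger
     block at [x], so the induction hypothesis applies with the same [Y]. *)
  have wT : `|x j + x K * z j| <= Y * T.
    apply: (IHm k.+1 (fun j => x j + x K * z j)) => //.
      lia.
    move=> h kh; have := Ax h (ltnW kh); rewrite splitK.
    under [in X in _ -> X]eq_bigr do rewrite mulrDr mulrCA.
    by rewrite big_split /= -mulr_sumr zE // addrC [x K * _]mulrC.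
  have : `|x j| <= `|x j + x K * z j| + `|x K * z j|.
    by rewrite -{1}(addrK (x K * z j) (x j)) ler_normB.
  have := zl j kj; rewrite normrM; have := normr_ge0 (x K); nra.
(* Row [K] with the bounds [xT] inserted; the term in [l K * |x K|] is moved to the left, where it
   forms the pivot. *)
have xK : (A K K - \sum_(j < n | (k < j)%N) `|A K j| * l K) * `|x K| <=
    Y + (\sum_(j < n | (k < j)%N) `|A K j|) * (Y * T).
  have := Ax K (leqnn k); rewrite splitK.
  set V := \sum_(j < n | _) _ => AxV.
  have VS : `|V| <= (\sum_(j < n | (k < j)%N) `|A K j|) *
      (Y * T + l K * `|x K|).
    apply: le_trans (ler_norm_sum _ _ _) _; rewrite mulr_suml.
    by apply: ler_sum => j kj; rewrite normrM ler_wpM2l // xT.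
  have : `|A K K * x K| <= `|A K K * x K + V| + `|V|.
    by rewrite -{1}(addrK V (A K K * x K)) ler_normB.
  rewrite normrM [`|A K K|]gtr0_norm ?sdd_diag_gt0 // -mulr_suml; lra.
have := b0 K; have := pA K; have := qA K; rewrite /= -mulr_suml.
move: xK; rewrite -mulr_suml.
set S := \sum_(j < n | _) _; set b := A K K - S * l K => xK qK pK bK.
have S0 : 0 <= S by apply: sumr_ge0.
have /andP[l0 l1] := l01 K.
have YT0 : 0 <= Y * T by rewrite mulr_ge0.
have SA : S <= A K K := ltW (sdd_tail K Asdd).
rewrite -(ler_pM2r bK).
have [<-|kNi] := eqVneq K i; first by rewrite mulrC; apply: le_trans xK _; nra.
have ki' : (k < i)%N by rewrite ltn_neqAle ki andbT.
have xi := xT i ki'.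
(* The identity [b + l K * S = A K K] collapses the estimate to [A K K * (Y * T) + l K * Y], which
   [qK], [pK] and [l K <= 1] bound. *)
have : b * `|x i| <= b * (Y * T) + l K * (b * `|x K|) by nra.
have : l K * (b * `|x K|) <= l K * (Y + S * (Y * T)) by apply: ler_wpM2l.
have -> : b * (Y * T) = (A K K - S * l K) * (Y * T) by [].
nra.
Qed.

(** * Adding the rank-one part *)

Lemma rank_one_bound (R : realFieldType) (n : nat) (B : 'M[R]_n)
    (c : 'I_n -> R) (G : R) :
  (1 < n)%N -> sdd B -> (forall i j, j != i -> B i j <= 0) ->
  (forall i, 0 <= c i) ->
  (forall (x : 'I_n -> R) (Y : R), 0 <= Y ->
     (forall i, `|\sum_j B i j * x j| <= Y) -> forall i, `|x i| <= Y * G) ->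
  forall (w : 'I_n -> R) (Y : R), 0 <= Y ->
    (forall i, `|\sum_j (B i j + c i) * w j| <= Y) ->
    forall i, `|w i| <= Y * ((n%:R - 1) * G).
Proof.
move=> n1 Bsdd Boff c0 BG w Y Y0 Bw i.
have [x xE] := sdd_solve xpredT c Bsdd.
have x0 : forall j, 0 <= x j.
  by apply: (sdd_monotone Bsdd Boff) => j; rewrite xE.
(* v = B^-1 (B + c e^T) w, so that w = v - s x with s = e^T v / (1 + e^T x). *)
pose s := \sum_j w j; pose S := \sum_j x j.
pose v j := w j + s * x j.
have vG j : `|v j| <= Y * G.
  apply: BG => // h; have := Bw h.
  under eq_bigr do rewrite mulrDl.
  under [in X in _ -> X]eq_bigr do rewrite mulrDr mulrCA.
  by rewrite !big_split /= -!mulr_sumr xE // [c h * _]mulrC.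
have vS : \sum_j v j = s * (1 + S).
  by rewrite big_split /= -mulr_sumr mulrDr mulr1.
have S0 : 0 <= S by apply: sumr_ge0.
have xiS : x i <= S by rewrite /S (bigD1 i) //= lerDl sumr_ge0.
have wE : (1 + S) * w i =
    v i * (1 + S - x i) - x i * \sum_(j < n | j != i) v j.
  have := vS; rewrite (bigD1 i) //= => /(canRL (addKr _)) ->.
  rewrite /v; ring.
have card_i : \sum_(j < n | j != i) Y * G = (n%:R - 1) * (Y * G).
  have : \sum_(j < n) Y * G = n%:R * (Y * G).
    by rewrite sumr_const card_ord mulr_natl.
  by rewrite (bigD1 i) //= mulrBl mul1r => <-; rewrite addrAC subrr add0r.
have leV : `|\sum_(j < n | j != i) v j| <= (n%:R - 1) * (Y * G).
  by rewrite -card_i; apply: le_trans (ler_norm_sum _ _ _) _; apply: ler_sum.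
have n2 : 2 <= n%:R :> R by rewrite ler_nat.
have S1 : 0 < 1 + S by lra.
rewrite -(ler_pM2l S1) -{1}[1 + S]gtr0_norm // -normrM wE.
apply: le_trans (ler_normB _ _) _; rewrite !normrM (ger0_norm (x0 i)).
rewrite [`|1 + S - _|]ger0_norm; last by lra.
have := vG i; have := x0 i; have YG0 : 0 <= Y * G := le_trans (normr_ge0 _) (vG i).
have : x i * `|\sum_(j < n | j != i) v j| <= x i * ((n%:R - 1) * (Y * G)).
  exact: ler_wpM2l.
(* The bound on [wE] is [Y * G] times [(1 + S - x i) + (n - 1) * x i = (1 + S) + (n - 2) * x i]; as
   [x i <= 1 + S] and [n >= 2], this is at most [(n - 1) * (1 + S)]. *)
have : x i * ((n%:R - 2) * (Y * G)) <= (1 + S) * ((n%:R - 2) * (Y * G)).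
  apply: ler_wpM2r; last by lra.
  by rewrite mulr_ge0 // subr_ge0.
have := @ler_wpM2r _ (1 + S - x i) _ `|v i| (Y * G).
nra.
Qed.

(** * Reduction of the norm to vectors, and dominance of [Bplus M] *)

Lemma mxnorm_oo_le (R : realType) (m n : nat) (A : 'M[R]_(m, n)) (K : R) :
  0 <= K ->
  (forall y : 'cV[R]_n, (forall i, `|y i 0| <= 1) ->
     forall i, `|(A *m y) i 0| <= K) ->
  mxnorm_oo A <= K.
Proof.
move=> K0 AK; have [y y1 <-] := mxnorm_oo_attained A.
have {}y1 j : `|y j 0| <= 1.
  apply: le_trans y1; have := le_bigmax 0 (fun i => \sum_(k < 1) `|y i k|) j.
  by rewrite big_ord1.
by apply/bigmax_leP; split=> // i _; rewrite big_ord1 AK.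
Qed.

Lemma lcoef_ge (R : realType) (n : nat) (B : 'M[R]_n) (k i : 'I_n) :
  sdd B -> (k <= i)%N ->
  \sum_(j < n | (k <= j)%N && (j != i)) `|B i j| <= lcoef B k * B i i.
Proof.
move=> Bsdd ki; have Bi := sdd_diag_gt0 i Bsdd.
rewrite -ler_pdivrMr // mulrC -div1r -{1}(gtr0_norm Bi).
exact: (@le_bigmax_cond _ _ _ 0 _ (fun i : 'I_n => (k <= i)%N)
  (fun i => 1 / `|B i i| * \sum_(j < n | (k <= j)%N && (j != i)) `|B i j|)).
Qed.

Lemma lcoef_le1 (R : realType) (n : nat) (B : 'M[R]_n) (k : 'I_n) :
  sdd B -> 0 <= lcoef B k <= 1.
Proof.
move=> Bsdd; apply/andP; split; first exact: bigmax_ge_id.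
apply/bigmax_leP; split=> // i ki; have Bi := sdd_diag_gt0 i Bsdd.
by rewrite div1r mulrC gtr0_norm // ler_pdivrMr // mul1r ltW // sdd_sub.
Qed.

Lemma beta_bar_gt0 (R : realType) (n : nat) (B : 'M[R]_n) (k : 'I_n) :
  sdd B -> 0 < beta_bar B k.
Proof.
move=> Bsdd; rewrite subr_gt0; apply: le_lt_trans (sdd_tail k Bsdd).
rewrite -mulr_suml; apply: ler_piMr; first exact: sumr_ge0.
by case/andP: (lcoef_le1 k Bsdd).
Qed.

Lemma beta_bar_le (R : realType) (n : nat) (B : 'M[R]_n) (k : 'I_n) :
  sdd B -> beta_bar B k <= B k k.
Proof.
move=> Bsdd; rewrite lerBlDr lerDl sumr_ge0 // => j _.
by rewrite mulr_ge0 //; case/andP: (lcoef_le1 k Bsdd).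
Qed.

Lemma rplus_ge0 (R : realType) (n : nat) (M : 'M[R]_n) (i : 'I_n) :
  0 <= rplus M i.
Proof. exact: bigmax_ge_id. Qed.

Lemma Bplus_offdiag_le0 (R : realType) (n : nat) (M : 'M[R]_n) (i j : 'I_n) :
  j != i -> Bplus M i j <= 0.
Proof. by move=> ji; rewrite mxE subr_le0; apply: le_bigmax_cond. Qed.

(** With nonpositive off-diagonal entries, dominance of a row is positivity of its sum, that is,
    [rplus M i] lies below the mean of row [i] of [M]. The two clauses of [B_matrix] say this for
    the seed 0 and for each off-diagonal entry. *)
Lemma Bplus_sdd (R : realType) (n : nat) (M : 'M[R]_n) :
  (0 < n)%N -> B_matrix M -> sdd (Bplus M).
Proof.
move=> n0 MB i; have [Mpos Mlt] := MB i.
under eq_bigr => j ji do rewrite ler0_norm ?Bplus_offdiag_le0 //.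
rewrite sumrN -subr_gt0 opprK.
suff : 0 < \sum_j Bplus M i j by rewrite (bigD1 i).
under eq_bigr do rewrite mxE.
rewrite sumrB sumr_const card_ord -mulr_natl subr_gt0 mulrC.
rewrite -ltr_pdivlMr ?ltr0n // mulrC.
by apply/bigmax_ltP; split=> //; rewrite mulr_gt0 // invr_gt0 ltr0n.
Qed.

(** * Bounds on solutions, uniform in [d] *)

Lemma lcp_mxE (R : realType) (n : nat) (B : 'M[R]_n) (d : 'rV[R]_n)
    (i j : 'I_n) :
  lcp_mx B d i j = (1 - d 0 i) * (i == j)%:R + d 0 i * B i j.
Proof.
rewrite !mxE (bigD1 i) //= big1 ?addr0 => [|k ki].
  by rewrite !mxE eqxx mulr1n; case: (i == j); rewrite /= ?mulr1n ?mulr0n; ring.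
by rewrite mxE eq_sym (negPf ki) mulr0n mul0r.
Qed.

Lemma lcp_mx_offdiag (R : realType) (n : nat) (B : 'M[R]_n) (d : 'rV[R]_n)
    (i j : 'I_n) :
  j != i -> lcp_mx B d i j = d 0 i * B i j.
Proof. by move=> ji; rewrite lcp_mxE eq_sym (negPf ji) mulr0 add0r. Qed.

Lemma lcp_mx_sdd (R : realType) (n : nat) (B : 'M[R]_n) (d : 'rV[R]_n) :
  sdd B -> unit_cube R n d -> sdd (lcp_mx B d).
Proof.
move=> Bsdd d01 i; have /andP[d0 d1] := d01 i.
under eq_bigr => j ji do rewrite lcp_mx_offdiag // normrM (ger0_norm d0).
rewrite -mulr_sumr lcp_mxE eqxx mulr1.
(* A row with [d 0 i = 0] is a row of the identity and gets its strictness from there, not from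
   [B]. *)
have [->|d_neq0] := eqVneq (d 0 i) 0; first lra.
have d_gt0 : 0 < d 0 i by rewrite lt_def d_neq0.
have := Bsdd i; nra.
Qed.

Definition lcp_bound (R : realType) (n : nat) (B : 'M[R]_n) : R :=
  tail_bound (fun i => (Num.min (beta_bar B i) 1)^-1)
    (fun i => B i i / beta_bar B i) 0.

(** The pivot [1 - d + d * beta_bar] is a convex combination of 1 and [beta_bar], hence at least
    their minimum. Since [beta_bar B k <= B k k], the ratio of diagonal entry to pivot is largest at
    [d = 1]. This removes [d] from the bound. *)
Lemma lcp_mx_bound (R : realType) (n : nat) (B : 'M[R]_n) (d : 'rV[R]_n) :
  sdd B -> unit_cube R n d ->
  forall (x : 'I_n -> R) (Y : R), 0 <= Y ->
    (forall i, `|\sum_j lcp_mx B d i j * x j| <= Y) ->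
    forall i, `|x i| <= Y * lcp_bound B.
Proof.
move=> Bsdd d01 x Y Y0 Bx i.
have betaE k : lcp_mx B d k k -
    \sum_(j < n | (k < j)%N) `|lcp_mx B d k j| * lcoef B k =
    1 - d 0 k + d 0 k * beta_bar B k.
  have /andP[d0 _] := d01 k.
  rewrite lcp_mxE eqxx mulr1 /beta_bar mulrBr mulr_sumr addrA.
  congr (_ - _); apply: eq_bigr => j kj.
  by rewrite lcp_mx_offdiag -?val_eqE ?gtn_eqF // normrM (ger0_norm d0) mulrA.
apply: (@trailing_bound _ _ (lcp_mx B d) (lcoef B)) => //.
- exact: lcp_mx_sdd.
- by move=> k; apply: lcoef_le1.
- move=> k {}i ki; have /andP[d0 d1] := d01 i.
  under eq_bigr => j /andP[_ ji] do
    rewrite lcp_mx_offdiag // normrM (ger0_norm d0).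
  have := lcoef_ge Bsdd (ltnW ki); have /andP[l0 _] := lcoef_le1 k Bsdd.
  rewrite -mulr_sumr lcp_mxE eqxx mulr1; nra.
- move=> k; have /andP[d0 d1] := d01 k.
  have b0 := beta_bar_gt0 k Bsdd.
  rewrite betaE mulrC ler_pdivlMr ?lt_min ?b0 ?ltr01 // mul1r.
  have [b1|b1] := leP (beta_bar B k) 1; rewrite -subr_ge0.
    rewrite [leRHS](_ : _ = (1 - d 0 k) * (1 - beta_bar B k)); last by ring.
    by rewrite mulr_ge0 ?subr_ge0.
  rewrite [leRHS](_ : _ = d 0 k * (beta_bar B k - 1)); last by ring.
  by rewrite mulr_ge0 // subr_ge0 ltW.
- move=> k; have /andP[d0 d1] := d01 k.
  have b0 := beta_bar_gt0 k Bsdd; have bB := beta_bar_le k Bsdd.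
  rewrite betaE mulrAC ler_pdivlMr // lcp_mxE eqxx mulr1 -subr_ge0.
  rewrite [leRHS](_ : _ = (1 - d 0 k) * (B k k - beta_bar B k)); last by ring.
  by rewrite mulr_ge0 ?subr_ge0.
Qed.

Lemma lcp_mx_Bplus (R : realType) (n : nat) (M : 'M[R]_n) (d : 'rV[R]_n)
    (i j : 'I_n) :
  lcp_mx M d i j = lcp_mx (Bplus M) d i j + d 0 i * rplus M i.
Proof. by rewrite !lcp_mxE mxE; ring. Qed.

Lemma B_matrix_lcp_bound (R : realType) (n : nat) (M : 'M[R]_n)
    (d : 'rV[R]_n) (w : 'I_n -> R) (Y : R) :
  (1 < n)%N -> B_matrix M -> unit_cube R n d -> 0 <= Y ->
  (forall i, `|\sum_j lcp_mx M d i j * w j| <= Y) ->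
  forall i, `|w i| <= Y * ((n%:R - 1) * lcp_bound (Bplus M)).
Proof.
move=> n1 MB d01 Y0 Mw.
have Bsdd : sdd (Bplus M) by apply: Bplus_sdd => //; apply: ltnW.
apply: (@rank_one_bound _ _ (lcp_mx (Bplus M) d) (fun i => d 0 i * rplus M i)).
- by [].
- exact: lcp_mx_sdd.
- move=> i j ji; have /andP[d0 _] := d01 i.
  by rewrite lcp_mx_offdiag // mulr_ge0_le0 // Bplus_offdiag_le0.
- by move=> i; have /andP[d0 _] := d01 i; rewrite mulr_ge0 // rplus_ge0.
- exact: lcp_mx_bound.
- by [].
- by move=> i; under eq_bigr do rewrite -lcp_mx_Bplus.
Qed.

(** A kernel vector satisfies the preceding bound with [Y = 0], so it vanishes. *)
Lemma lcp_mx_unit (R : realType) (n : nat) (M : 'M[R]_n) (d : 'rV[R]_n) :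
  (1 < n)%N -> B_matrix M -> unit_cube R n d -> lcp_mx M d \in unitmx.
Proof.
move=> n1 MB d01; apply: unitmx_ker0 => x Mx0; apply/matrixP => i j.
rewrite ord1 [RHS]mxE; apply/eqP; rewrite -normr_le0.
apply: le_trans (B_matrix_lcp_bound (w := fun j => x j 0) (Y := 0)
  n1 MB d01 _ _ i) _ => // [k|]; last by rewrite mul0r.
by have := congr1 (fun y : 'cV[R]_n => y k 0) Mx0; rewrite !mxE => ->;
  rewrite normr0.
Qed.

(** * Continuity and existence of the maximum *)

Lemma mxnorm_oo_cvg (R : realType) (T : Type) (F : set_system T) (m n : nat)
    (f : T -> 'M[R]_(m, n)) (A : 'M[R]_(m, n)) :
  Filter F -> (forall i j, f t i j @[t --> F] --> A i j) ->
  mxnorm_oo (f t) @[t --> F] --> mxnorm_oo A.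
Proof.
move=> FF fA; apply: cvg_big => // [|i _]; first exact: max_continuous.
apply: cvg_big => // [|j _]; first exact: add_continuous.
exact: cvg_norm.
Qed.

Lemma det_cvg (R : realType) (T : Type) (F : set_system T) (n : nat)
    (f : T -> 'M[R]_n) (A : 'M[R]_n) :
  Filter F -> (forall i j, f t i j @[t --> F] --> A i j) ->
  \det (f t) @[t --> F] --> \det A.
Proof.
move=> FF fA; apply: cvg_big => // [|s _]; first exact: add_continuous.
apply: cvgM; first exact: cvg_cst.
by apply: cvg_big => //; exact: mul_continuous.
Qed.

(** Cramer's formula stands in for [invmx] along the filter because [invmx] is defined by cases on
    invertibility; thus only the limit has to be invertible. *)
Lemma invmx_formula_cvg (R : realType) (T : Type) (F : set_system T) (n : nat)
    (f : T -> 'M[R]_n) (A : 'M[R]_n) :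
  Filter F -> A \in unitmx -> (forall i j, f t i j @[t --> F] --> A i j) ->
  forall i j, ((\det (f t))^-1 *: \adj (f t)) i j @[t --> F] --> invmx A i j.
Proof.
move=> FF Au fA i j; rewrite /invmx Au mxE.
under eq_cvg do rewrite mxE.
have detA : \det A != 0 by rewrite -unitfE -unitmxE.
apply: cvgM; first by apply: cvgV => //; apply: det_cvg.
rewrite mxE; under eq_cvg do rewrite mxE.
apply: cvgM; first exact: cvg_cst.
apply: det_cvg => k l; rewrite !mxE.
by under eq_cvg do rewrite !mxE; exact: fA.
Qed.

Lemma lcp_mx_cvg (R : realType) (T : Type) (F : set_system T) (n : nat)
    (M : 'M[R]_n) (f : T -> 'rV[R]_n) (d : 'rV[R]_n) :
  Filter F -> (forall i, f t 0 i @[t --> F] --> d 0 i) ->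
  forall i j, lcp_mx M (f t) i j @[t --> F] --> lcp_mx M d i j.
Proof.
move=> FF fd i j; rewrite lcp_mxE; under eq_cvg do rewrite lcp_mxE.
apply: cvgD; last by apply: cvgM; [exact: fd | exact: cvg_cst].
apply: cvgM; last exact: cvg_cst.
by apply: cvgB; [exact: cvg_cst | exact: fd].
Qed.

Lemma unit_cube_compact (R : realType) (n : nat) : compact (unit_cube R n).
Proof.
have -> : unit_cube R n = [set d | forall i, `[0, 1]%classic (d ord0 i)].
  by apply/seteqP; split=> d d01 i; have := d01 i; rewrite /= in_itv.
apply: (@rV_compact R n (fun=> `[0, 1]%classic)) => i.
exact: segment_compact.
Qed.

Lemma lcp_mx_norm_max (R : realType) (n : nat) (M : 'M[R]_n) :
  (forall d, unit_cube R n d -> lcp_mx M d \in unitmx) ->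
  exists mu, is_maximum
    [set mxnorm_oo (invmx (lcp_mx M d)) | d in unit_cube R n] mu.
Proof.
move=> Mu.
(* [g] is the norm of the inverse on the cube, and is continuous at its points even along neighbours
   outside the cube, where [lcp_mx M d] may be singular. *)
pose g (d : 'rV[R]_n) : R :=
  mxnorm_oo ((\det (lcp_mx M d))^-1 *: \adj (lcp_mx M d)).
have gE d : unit_cube R n d -> g d = mxnorm_oo (invmx (lcp_mx M d)).
  by move=> d01; rewrite /invmx Mu.
have g_cont : {within unit_cube R n, continuous g}.
  apply: continuous_in_subspaceT => d /set_mem d01.
  have di i : (fun e : 'rV[R]_n => e 0 i) @ nbhs d --> d 0 i.
    exact: coord_continuous.
  have Md := lcp_mx_cvg (M := M) (f := id) (nbhs_filter d) di.
  rewrite /continuous_at gE //.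
  exact: mxnorm_oo_cvg (invmx_formula_cvg (nbhs_filter d) (Mu d d01) Md).
have cube0 : unit_cube R n !=set0.
  by exists 0 => i; rewrite mxE lexx ler01.
have [d /set_mem d01 dmax] :=
  compact_EVT_max cube0 (@unit_cube_compact R n) g_cont.
exists (mxnorm_oo (invmx (lcp_mx M d))); split; first by exists d.
by move=> _ [e e01 <-]; rewrite -!gE // dmax // inE.
Qed.

(** * The bound at a maximizing [d] *)

Unset Implicit Arguments.

Theorem theorem7 (R : realType) (n : nat) (M : 'M[R]_n)
    (hn : (1 < n)%N) (hM : B_matrix M) :
  (forall d : 'rV[R]_n, unit_cube R n d -> lcp_mx M d \in unitmx) /\
  exists mu : R,
    is_maximum [set mxnorm_oo (invmx (lcp_mx M d)) | d in unit_cube R n] mu /\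
    mu <= \sum_(i < n)
            (n%:R - 1) / Num.min (beta_bar (Bplus M) i) 1 *
            \prod_(j < n | (j < i)%N)
              (Bplus M j j / beta_bar (Bplus M) j).
Proof.
have Munit d : unit_cube R n d -> lcp_mx M d \in unitmx.
  exact: lcp_mx_unit.
split=> //; have [mu mu_max] := lcp_mx_norm_max Munit.
exists mu; split=> //; have [[d d01 <-] _] := mu_max.
under eq_bigr do rewrite -mulrA.
(* Once [n - 1] is factored out, the guards [0 <= i] and [0 <= j] of [tail_bound] at 0 compute away
   and the two sums agree. *)
rewrite -mulr_sumr [X in _ * X](_ : _ = lcp_bound (Bplus M)) //.
have Bsdd : sdd (Bplus M) by apply: Bplus_sdd => //; apply: ltnW.
apply: mxnorm_oo_le => [|y y1 i].
  rewrite mulr_ge0 ?subr_ge0 ?ler1n ?(ltnW hn) //.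
  apply: tail_bound_ge0 => k; have b0 := beta_bar_gt0 k Bsdd.
    by rewrite invr_ge0 le_min ltW //=.
  by rewrite divr_ge0 ?ltW // sdd_diag_gt0.
(* The entries of [y] are at most 1 in absolute value, so the solution bound is used with
   [Y = 1]. *)
rewrite -[leRHS]mul1r.
apply: (B_matrix_lcp_bound (w := fun j => (invmx (lcp_mx M d) *m y) j 0)
  hn hM d01) => // k.
have /matrixP/(_ k 0) := mulKVmx (Munit d d01) y.
by rewrite mxE => ->.
Qed.
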